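(* Let $\mathbb{F}$ be a field of characteristic $p>0$, let $n$ be a positive integer and $d$ a non-negative integer, let $R=\mathbb{F}[x_1,\ldots,x_n]$, and let $R^{\mathfrak{S}_n}$ be the ring of symmetric polynomials. Let $I_{n,d}=(x_1^{d+1},\ldots,x_n^{d+1})R\cap R^{\mathfrak{S}_n}$. Let $t=\max\{i\in\mathbb{N}\mid p^i\leq n\}$ and let $q_0,\ldots,q_t$ be positive integers such that, for every $i\in\{0,\ldots,t\}$, $n=q_i p^i+r_i$ with $0\leq r_i<p^i$. For every $i\in\{0,\ldots,t\}$, define the ideal of $R^{\mathfrak{S}_n}$ \[J_{n,d,i}=\bigl(m_{((d+1)^{p^i})},\ldots,m_{((d+q_i)^{p^i})}\bigr).\] Then $I_{n,d}=J_{n,d,0}+J_{n,d,1}+\cdots+J_{n,d,t}$.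
   Context: $\mathbb{N}$ includes $0$. The symmetric group $\mathfrak{S}_n$ acts on $R$ by permuting the variables, and $R^{\mathfrak{S}_n}\subseteq R$ is the subring of invariants. A partition is a non-increasing sequence of non-negative integers with finitely many nonzero terms (trailing zeros are ignored); its length $l(\lambda)$ is the number of nonzero terms. For a partition $\lambda$ with $l(\lambda)\leq n$, the monomial symmetric polynomial is $m_\lambda=\sum x_1^{\alpha_1}\cdots x_n^{\alpha_n}\in R^{\mathfrak{S}_n}$, summed over all distinct permutations $(\alpha_1,\ldots,\alpha_n)$ of $(\lambda_1,\ldots,\lambda_n)$. The notation $(a^b)$ denotes the partition with the part $a$ repeated $b$ times. The ideals $J_{n,d,i}$ are generated over $R^{\mathfrak{S}_n}$. *)

(* Defs.v *)
From HB Require Import structures.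
From mathcomp Require Import all_boot all_order all_fingroup all_algebra.
From mathcomp Require Import mpoly.
Set Implicit Arguments.
Unset Strict Implicit.
Unset Printing Implicit Defensive.
Import GRing.Theory.
Local Open Scope ring_scope.

(* Ideals are Prop-valued predicates: MathComp's idealr is restricted to proper
   ideals with decidable membership. *)
Definition ideal_gen (A : comPzRingType) (k : nat) (g : 'I_k -> A) : A -> Prop :=
  fun f => exists c : 'I_k -> A, f = \sum_(j < k) c j * g j.

Definition ideal_sum (A : comPzRingType) (k : nat) (J : 'I_k -> A -> Prop) :
    A -> Prop :=
  fun f => exists g : 'I_k -> A, (forall i, J i (g i)) /\ f = \sum_(i < k) g i.

Section SymmetricPolynomials.
Variables (F : fieldType) (n : nat).

Record sympoly := SymPoly {
  sympoly_val : {mpoly F[n]};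
  _ : sympoly_val \is symmetric }.

HB.instance Definition _ := [isSub for sympoly_val].
HB.instance Definition _ := [Choice of sympoly by <:].
HB.instance Definition _ := [SubChoice_isSubComNzRing of sympoly by <:].

(* A partition is a list of naturals, read with infinitely many trailing zeros.
   [permutations] lists each rearrangement of (lam_1, ..., lam_n) exactly once.
   Meaningful only if lam has at most n nonzero parts. *)
Definition monomial_sum (lam : seq nat) : {mpoly F[n]} :=
  \sum_(a <- permutations (mkseq (nth 0%N lam) n))
     'X_[[multinom nth 0%N a i | i < n]].

Lemma mcoeff_monomial_sum lam (m : 'X_{1..n}) :
  (monomial_sum lam)@_m = (perm_eq m (mkseq (nth 0%N lam) n))%:R.
Proof.
set w := mkseq _ n; have szw : size w = n by rewrite size_mkseq.
have E a : a \in permutations w ->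
    ([multinom nth 0%N a i | i < n] == m) = (a == m :> seq nat).
  rewrite mem_permutations => /perm_size; rewrite szw => sza.
  apply/eqP/eqP => [<-|->].
    apply: (@eq_from_nth _ 0%N); rewrite ?size_tuple // => i.
    rewrite sza => lti; have := mnmE (fun i => nth 0%N a i) (Ordinal lti).
    by rewrite /= mnm_tnth (tnth_nth 0%N).
  by apply/mnmP=> i; rewrite mnmE mnm_tnth (tnth_nth 0%N).
rewrite /monomial_sum raddf_sum /= big_seq.
rewrite (eq_bigr (fun a => ((a == m :> seq nat)%:R : F))); last first.
  by move=> a /E <-; rewrite mcoeffX.
rewrite -big_seq -mem_permutations -count_uniq_mem ?permutations_uniq //.
by rewrite -natr_sum -sum1_count [in RHS]big_mkcond.
Qed.

Lemma monomial_sum_sym lam : monomial_sum lam \is symmetric.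
Proof.
apply/issymP=> s; apply/mpolyP=> m; rewrite mcoeff_sym !mcoeff_monomial_sum.
congr (nat_of_bool _)%:R; apply: permPl; rewrite perm_sym.
apply/tuple_permP; exists s^-1%g; congr (tval _).
by apply: eq_from_tnth=> i; rewrite !tnth_mktuple permKV.
Qed.

Definition msymp (lam : seq nat) : sympoly := SymPoly (monomial_sum_sym lam).

Definition I_ideal (d : nat) : sympoly -> Prop :=
  fun f => ideal_gen (fun k : 'I_n => 'X_k ^+ d.+1) (val f).

Definition J_ideal (d p i q : nat) : sympoly -> Prop :=
  ideal_gen (fun j : 'I_q => msymp (nseq (p ^ i)%N (d + j.+1)%N)).

End SymmetricPolynomials.

(* Main.v *)
Require Import Defs.
From mathcomp Require Import all_boot all_order all_fingroup all_algebra.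
From mathcomp Require Import pgroup sylow.
From mathcomp Require Import mpoly.
Set Implicit Arguments.
Unset Strict Implicit.
Unset Printing Implicit Defensive.
Import GRing.Theory.

(** The ideal [I] consists of the symmetric polynomials in which every monomial
    has an exponent above [d], so the generators of the [J_i] belong to [I].
    For the converse, filter [I] by powers of [p]: say that a monomial is
    irregular for [p ^ i] if one of the values above [d] occurs among its
    exponents with a multiplicity not divisible by [p ^ i].  Since [n < p ^ t.+1],
    every monomial of an element of [I] is irregular for [p ^ t.+1].

    The first key fact ([irregular_generated]) is that a symmetric polynomial
    with only [p ^ i]-irregular monomials lies in the ideal generated by the
    [m_((a^(p^l)))] with [l < i] and [a > d].  One peels [p ^ l] equal parts [a]
    off a partition, [p ^ l] being the [p]-part of their multiplicity [u], and
    multiplies back by [m_((a^(p^l)))].  The leading coefficient ['C(u, p ^ l)]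
    is nonzero in [F] ([bin_logn_neq0]), and the other terms have fewer parts.
    They also stay irregular: the coefficient of a regular monomial counts a
    family of sets stable under a Young subgroup, and a Sylow subgroup acting
    on that family without fixed points shows that the count is divisible by
    [p] ([invariant_family_dvd]).

    The second key fact ([newton_irregular]) is a Newton identity modulo
    irregular monomials: for [k = p ^ i], the alternating sum of the products
    [m_(((a-j)^k)) * m_((1^(jk)))] for [0 <= j <= q_i] has only irregular
    monomials if [a > d + q_i], because [n < (q_i + 1) * k].  Hence, modulo the
    ideal generated by the [m_((b^(p^l)))] with [l < i] and [b > d], each
    [m_((a^k))] with [a > d + q_i] is a combination of the [q_i] preceding ones,
    with symmetric polynomials as coefficients, and an induction on [a] leaves only
    [a = d + 1, ..., d + q_i], the generators of [J_i]. *)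

(** * Counting invariant families of sets modulo p *)

Section Young.
Local Open Scope group_scope.
Variables (T : finType) (h : T -> nat).

(** The Young subgroup of the partition of [T] into fibres of [h]. *)
Definition young : {set {perm T}} := [set s : {perm T} | [forall x, h (s x) == h x]].

Lemma youngP (s : {perm T}) : reflect (forall x, h (s x) = h x) (s \in young).
Proof. by rewrite inE; apply: (iffP forallP) => fixh x; apply/eqP. Qed.

Lemma young_group_set : group_set young.
Proof.
apply/group_setP; split=> [|s u /youngP hs /youngP hu]; apply/youngP=> x.
  by rewrite perm1.
by rewrite permM hu hs.
Qed.

Canonical young_group := Group young_group_set.

Lemma young_orbit x : orbit 'P young x = [set y | h y == h x].
Proof.
apply/setP=> y; rewrite inE; apply/orbitP/eqP => [[s /youngP hs <-]|hyx].
  exact: hs.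
exists (tperm x y); last by rewrite /= apermE tpermL.
by apply/youngP=> z; case: tpermP => // ->.
Qed.

(** The stabiliser of [x] in the Young subgroup [G] has index [|h^-1 (h x)|],
    hence its intersection with the Sylow subgroup [P] has index in [G]
    divisible by [p ^ i]; that index is also [|G : P| * |orbit|], and
    [|G : P|] is prime to [p]. *)
Lemma sylow_orbit_dvd p i x (P : {group {perm T}}) : prime p ->
  p.-Sylow(young) P -> p ^ i %| #|[set y | h y == h x]| ->
  p ^ i %| #|orbit 'P P x|.
Proof.
move=> pp sylP; rewrite -young_orbit !card_orbit => kG.
have sPG := pHall_sub sylP.
have : p ^ i %| #|young : 'C_P[x | 'P]|.
  rewrite -(@Lagrange_index _ young 'C_young[x | 'P] 'C_P[x | 'P]) ?subsetIl ?setSI //.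
  by rewrite dvdn_mulr.
rewrite -(Lagrange_index sPG) ?subsetIl // mulnC Gauss_dvdl //.
rewrite coprimeXl // prime_coprime // -p'natE //.
by case/and3P: sylP.
Qed.

(** A Sylow [p]-subgroup of the Young subgroup acts on the family [FF].  A fixed
    member would be a union of orbits of points, all of size divisible by
    [p ^ i], which its cardinality forbids; so every orbit on [FF] is
    nontrivial. *)
Lemma invariant_family_dvd p i (FF : {set {set T}}) : prime p ->
    (forall s : {perm T}, (forall x, h (s x) = h x) ->
       forall S, S \in FF -> s @: S \in FF) ->
    (forall S, S \in FF -> ~~ (p ^ i %| #|S|)) ->
    (forall S x, S \in FF -> x \in S -> p ^ i %| #|[set y | h y == h x]|) ->
  p %| #|FF|.
Proof.
move=> pp FFinv FFcard FFlev.
have [P sylP] := Sylow_exists p young_group.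
have sPG := pHall_sub sylP.
have actP : [acts P, on FF | 'P^*].
  apply/actsP=> s /(subsetP sPG)/youngP hs S; apply/idP/idP => [sS|]; last exact: FFinv.
  rewrite -(actKin ('P^*) (in_setT s) S) //=; apply: FFinv => // x.
  by rewrite -[in RHS](permKV s x) hs.
rewrite /dvdn (pgroup_fix_mod (pHall_pgroup sylP) actP).
suff -> : 'Fix_(FF | 'P^*)(P) = set0 by rewrite cards0 mod0n.
apply/eqP; rewrite -subset0; apply/subsetP=> S /setIP[SF /afixP fixS].
have actS : [acts P, on S | 'P].
  apply/actsP=> s sP x.
  by rewrite -{1}(fixS s sP); apply/mem_imset/(act_inj 'P).
case/negP: (FFcard S SF); rewrite -(acts_sum_card_orbit actS).
apply: dvdn_sum => _ /imsetP[x xS ->].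
by apply: sylow_orbit_dvd => //; apply: FFlev SF xS.
Qed.
End Young.

(** * A binomial coefficient prime to p *)

Section Binomial.
Local Open Scope ring_scope.
Variable F : fieldType.

Lemma coef_exp1DX u v : ((1 + 'X : {poly F}) ^+ u)`_v = 'C(u, v)%:R.
Proof.
rewrite exprDn (eq_bigr (fun i : 'I_u.+1 => 'C(u, i)%:R *: 'X^i)) => [|i _].
  have [vu|uv] := leqP v u.
    rewrite coef_sum (bigD1 (Ordinal (n:=u.+1) vu)) //= big1 => [|i /negPf ni].
      by rewrite coefZ coefXn eqxx mulr1 addr0.
    rewrite coefZ coefXn eq_sym; case: eqP => [e|]; last by rewrite mulr0.
    by case/eqP: ni; apply: val_inj.
  rewrite coef_sum big1 ?bin_small // => i _.
  rewrite coefZ coefXn gtn_eqF ?mulr0 //.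
  by rewrite (leq_ltn_trans _ uv) // -ltnS.
by rewrite expr1n mul1r scaler_nat.
Qed.

(** With [k] the [p]-part of [u] and [w = u / k], the Frobenius identity
    [(1 + X)^u = (1 + X^k)^w] shows that this binomial is [w] modulo [p]. *)
Lemma bin_logn_neq0 (p u : nat) : p \in [pchar F] ->
  (0 < u)%N -> 'C(u, p ^ logn p u)%:R != 0 :> F.
Proof.
move=> charFp u0; have pp := pcharf_prime charFp.
set k := (p ^ logn p u)%N.
have k0 : (0 < k)%N by rewrite expn_gt0 prime_gt0.
have kdvd : (k %| u)%N by rewrite pfactor_dvdn.
have kp : [pchar {poly F}].-nat k.
  rewrite pnatX; apply/orP; left; rewrite pnatE //.
  by rewrite (rmorph_pchar (@polyC F)).
pose w := (u %/ k)%N.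
have -> : 'C(u, k)%:R = (w%:R : F).
  rewrite -coef_exp1DX -(divnK kdvd) mulnC exprM exprDn_pchar // expr1n -/w.
  rewrite exprDn coef_sum.
  case: w => [|w].
    by rewrite big_ord_recl big_ord0 /= bin0 !expr0 mulr1 coef1 gtn_eqF ?addr0.
  rewrite !big_ord_recl big1 => [|i _].
    rewrite /= expr0 expr1n mulr1 mulr1n coef1 gtn_eqF // add0r addr0.
    by rewrite expr1n mul1r expr1 bin1 coefMn coefXn eqxx.
  rewrite expr1n mul1r -exprM coefMn coefXn ltn_eqF ?mul0rn //=.
  by rewrite /bump /= !add1n -{1}[k]muln1 ltn_pmul2l.
rewrite -(dvdn_pcharf charFp) /w.
have := pfactor_coprime pp u0; case=> m cop e.
by rewrite {1}e mulnK // -prime_coprime.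
Qed.

End Binomial.

(** * Level sets of exponent vectors and symmetric sums *)

Section Levels.
Local Open Scope ring_scope.
Variable n : nat.
Implicit Types (m : 'X_{1..n}) (S T : {set 'I_n}) (a b d k : nat).

Definition level m b : {set 'I_n} := [set i | m i == b].
Definition const_on a S : 'X_{1..n} := [multinom (a * (i \in S))%N | i < n].

Lemma perm_eq_reindex m1 m2 (s : {perm 'I_n}) :
  (forall i, m1 (s i) = m2 i) -> perm_eq m1 m2.
Proof.
move=> e; rewrite perm_sym; apply/tuple_permP; exists s; congr (tval _).
by apply: eq_from_tnth => i; rewrite tnth_mktuple -!mnm_tnth e.
Qed.

Lemma count_level m b : count_mem b m = #|level m b|.
Proof.
have -> : tval m = [seq m i | i <- enum 'I_n].
  have -> : tval m = tval [tuple tnth m i | i < n].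
    by congr (tval _); apply: eq_from_tnth => i; rewrite tnth_mktuple.
  by apply: eq_map => i; rewrite mnm_tnth.
rewrite count_map -sum1_count -sum1_card big_enum_cond /=.
by apply: eq_bigl => i; rewrite inE.
Qed.

Lemma perm_eq_levelP m1 m2 :
  reflect (forall b, #|level m1 b| = #|level m2 b|) (perm_eq m1 m2).
Proof.
apply: (iffP idP) => [/seq.permP e b|e]; first by rewrite -!count_level e.
by apply/allP => b _ /=; rewrite !count_level e.
Qed.

Lemma const_onE a S i : const_on a S i = (a * (i \in S))%N.
Proof. exact: mnmE. Qed.

Lemma const_on_leP a S m :
  reflect (forall i, i \in S -> a <= m i)%N (const_on a S <= m)%MM.
Proof.
apply: (iffP mnm_lepP) => [le_m i iS|le_m i]; rewrite ?const_onE.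
  by have := le_m i; rewrite const_onE iS muln1.
by case: (boolP (i \in S)) => [/le_m|]; rewrite ?muln1 ?muln0.
Qed.

(** Subtracting [a] on [S] turns the value [b] into another one at the places of
    [S] where [m] is [b], and creates a [b] at those where [m] is [a + b]. *)
Lemma level_sub_const_on a S m b : (0 < a)%N -> (const_on a S <= m)%MM ->
  (#|level (m - const_on a S)%MM b| + #|S :&: level m b| =
   #|level m b| + #|S :&: level m (a + b)|)%N.
Proof.
move=> a0 /const_on_leP le_m.
have -> : level (m - const_on a S)%MM b = (level m b :\: S) :|: (S :&: level m (a + b)).
  apply/setP=> i; rewrite !inE mnmBE const_onE.
  case: (boolP (i \in S)) => [/le_m am|_] /=; last by rewrite muln0 subn0 orbF.
  by rewrite muln1 -(eqn_add2l a) subnKC.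
rewrite cardsU (_ : (_ :\: _) :&: _ = set0) ?cards0 ?subn0; last first.
  by apply/setP=> i; rewrite !inE; case: (i \in S); rewrite ?andbF.
by rewrite addnAC (setIC S (level m b)) [(#|_ :\: _| + _)%N]addnC cardsID.
Qed.

Lemma card_level_const_on a S b : (0 < a)%N ->
  #|level (const_on a S) b| = (if b == a then #|S| else if b == 0 then n - #|S| else 0)%N.
Proof.
move=> a0; case: (eqVneq b a) => [->|ba].
  congr #|pred_of_set _|; apply/setP=> i; rewrite inE const_onE.
  case: (i \in S); rewrite ?muln1 ?eqxx // muln0 eq_sym.
  by apply/negbTE; rewrite -lt0n.
case: (eqVneq b 0%N) => [->|b0].
  rewrite -[n in (n - _)%N]card_ord -(cardsC S) addKn.
  congr #|pred_of_set _|; apply/setP=> i.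
  by rewrite !inE const_onE; case: (i \in S); rewrite ?muln1 ?muln0 // gtn_eqF.
apply: eq_card0 => i; rewrite !inE const_onE.
by case: (i \in S); rewrite ?muln1 ?muln0 eq_sym; apply/negbTE.
Qed.

(** Quantifying over places [i] rather than over values [m i] makes this a
    boolean, and a value that is not attained has multiplicity [0], which is
    divisible by [k]. *)
Definition irregular d k m :=
  [exists i, (d < m i)%N && ~~ (k %| #|level m (m i)|)%N].

End Levels.

Section SymmetricSums.
Local Open Scope ring_scope.
Variables (F : fieldType) (n : nat).
Implicit Types (m : 'X_{1..n}) (S T : {set 'I_n}) (f g : {mpoly F[n]}).

Lemma symmetric_coeff f m1 m2 : f \is symmetric -> perm_eq m1 m2 ->
  f@_m1 = f@_m2.
Proof.
move=> /issymP fsym /tuple_permP[s e].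
suff -> : m1 = [multinom m2 (s i) | i < n] by rewrite -mcoeff_sym fsym.
by apply/mnmP=> i; rewrite mnmE !mnm_tnth (tnth_nth 0%N) e -tnth_nth tnth_mktuple.
Qed.

Lemma mcoeff_msymp m1 m : (val (msymp F n m1))@_m = (perm_eq m m1)%:R.
Proof.
rewrite mcoeff_monomial_sum.
suff -> : mkseq (nth 0%N m1) n = m1 by [].
by have := mkseq_nth 0%N m1; rewrite size_tuple.
Qed.

(** The [k]-th elementary symmetric polynomial in the powers [x_i ^ a]; it is
    [m_((a^k))] when [0 < a] and [k <= n] (see [val_msymp_nseq]), and this
    form, indexed by subsets, is the one that multiplies well. *)
Definition block k a : {mpoly F[n]} :=
  \sum_(S : {set 'I_n} | #|S| == k) 'X_[const_on a S].

Lemma val_msymp_nseq k a : (0 < a)%N -> (k <= n)%N ->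
  val (msymp F n (nseq k a)) = block k a.
Proof.
move=> a0 kn; apply/mpolyP => m; rewrite mcoeff_monomial_sum.
pose S0 := [set i : 'I_n | (i < k)%N].
have cS0 : #|S0| = k.
  rewrite /S0 -sum1_card (eq_bigl (fun i : 'I_n => i < k)%N) => [|i]; last by rewrite inE.
  by rewrite (big_ord_narrow kn) sum1_card card_ord.
have -> : mkseq (nth 0%N (nseq k a)) n = const_on a S0.
  apply: (@eq_from_nth _ 0%N) => [|i]; rewrite size_mkseq ?size_tuple // => lti.
  rewrite nth_mkseq // nth_nseq.
  have := const_onE a S0 (Ordinal lti); rewrite mnm_tnth (tnth_nth 0%N) /= => ->.
  by rewrite inE /=; case: (i < k)%N; rewrite ?muln1 ?muln0.
rewrite /block raddf_sum /=.
rewrite (eq_bigr (fun S => (const_on a S == m)%:R)) => [|S _]; last first.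
  by rewrite mcoeffX.
case: (perm_eq_levelP m (const_on a S0)) => [e|ne].
  have lvla S : level (const_on a S) a = S.
    apply/setP=> i; rewrite inE const_onE; case: (i \in S); rewrite ?muln1 ?eqxx //.
    by rewrite muln0 eq_sym; apply/negbTE; rewrite -lt0n.
  have mE : m = const_on a (level m a).
    apply/mnmP=> i; rewrite const_onE inE; case: (eqVneq (m i) a) => [->|ma].
      by rewrite muln1.
    rewrite muln0; apply/eqP; apply: contraT => m0.
    have : level m (m i) != set0 by apply/set0Pn; exists i; rewrite inE.
    rewrite -card_gt0 e card_gt0 => /set0Pn[j]; rewrite inE const_onE.
    by case: (j \in S0); rewrite ?muln1 ?muln0 eq_sym ?(negPf ma) ?(negPf m0).
  rewrite (bigD1 (level m a)) /=; last by rewrite e lvla cS0.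
  rewrite -mE eqxx big1 ?addr0 // => S /andP[_ /eqP neS].
  by case: eqP => // eS; case: neS; rewrite -eS lvla.
rewrite big1 // => S /eqP cS; case: eqP => // eS; case: ne => b; rewrite -eS.
by rewrite !card_level_const_on // cS cS0.
Qed.

Lemma block0 a : block 0 a = 1.
Proof.
rewrite /block (eq_bigl (pred1 set0)) => [|S]; last by rewrite cards_eq0.
rewrite big_pred1_eq (_ : const_on a set0 = 0%MM) ?mpolyX0 //.
by apply/mnmP=> i; rewrite const_onE inE muln0 mnm0E.
Qed.

Lemma mcoeff_blockM k a g m : (block k a * g)@_m =
  \sum_(S : {set 'I_n} | (#|S| == k) && (const_on a S <= m)%MM) g@_(m - const_on a S).
Proof.
rewrite /block mulr_suml raddf_sum /= big_mkcondr /=; apply: eq_bigr => S _.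
rewrite mulrC; case: ifP => [/submK e|nle].
  by rewrite -{1}e addmC mcoeffMX.
apply: memN_msupp_eq0; rewrite (perm_mem (msuppMX _ _)); apply/mapP=> -[m' _ e].
by case/negP: nle; rewrite e lem_addr.
Qed.
End SymmetricSums.

(** * Irregular symmetric polynomials *)

Section Ideals.
Local Open Scope ring_scope.

Definition is_ideal (A : comPzRingType) (J : A -> Prop) : Prop :=
  [/\ J 0, forall x y, J x -> J y -> J (x + y) & forall c x, J x -> J (c * x)].

Lemma ideal_big_sum (A : comPzRingType) (J : A -> Prop) (idJ : is_ideal J)
    (I : eqType) (r : seq I) (x : I -> A) :
  (forall i, i \in r -> J (x i)) -> J (\sum_(i <- r) x i).
Proof.
case: idJ => J0 JD _ Jx; rewrite big_seq.
by elim/big_ind: _ => //; exact: Jx.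
Qed.

Lemma ideal_gen_ideal (A : comPzRingType) k (g : 'I_k -> A) :
  is_ideal (ideal_gen g).
Proof.
split=> [|x y [c ->] [e ->]|b x [c ->]].
- by exists (fun=> 0); rewrite big1 // => j _; rewrite mul0r.
- exists (fun j => c j + e j); rewrite -big_split.
  by apply: eq_bigr => j _; rewrite mulrDl.
- exists (fun j => b * c j); rewrite mulr_sumr.
  by apply: eq_bigr => j _; rewrite mulrA.
Qed.

Lemma ideal_gen_mem (A : comPzRingType) k (g : 'I_k -> A) j : ideal_gen g (g j).
Proof.
exists (fun j' => (j' == j)%:R); rewrite (bigD1 j) //= eqxx mul1r big1 ?addr0 //.
by move=> j' /negPf->; rewrite mul0r.
Qed.

Lemma ideal_sum_ideal (A : comPzRingType) k (J : 'I_k -> A -> Prop) :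
  (forall i, is_ideal (J i)) -> is_ideal (ideal_sum J).
Proof.
move=> idJ; split=> [|x y [g [Jg ->]] [h [Jh ->]]|b x [g [Jg ->]]].
- by exists (fun=> 0); split=> [i|]; [case: (idJ i) | rewrite big1].
- exists (fun i => g i + h i); split; last by rewrite big_split.
  by move=> i; case: (idJ i) => _ + _; apply.
- exists (fun i => b * g i); split; last by rewrite mulr_sumr.
  by move=> i; case: (idJ i) => _ _; apply.
Qed.

Lemma ideal_sum_sub (A : comPzRingType) k (J : 'I_k -> A -> Prop) i x :
  (forall i', is_ideal (J i')) -> J i x -> ideal_sum J x.
Proof.
move=> idJ Jx; exists (fun i' => if i' == i then x else 0); split=> [i'|].
  by case: eqP => [->|_] //; case: (idJ i').
by rewrite -big_mkcond big_pred1_eq.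
Qed.

End Ideals.

Section Generation.
Local Open Scope ring_scope.
Variables (F : fieldType) (n d : nat).
Implicit Types (m : 'X_{1..n}) (S T : {set 'I_n}) (f g : sympoly F n).

Lemma val_sympolyM f g : val (f * g) = val f * val g.
Proof. exact: rmorphM. Qed.

Lemma val_sympolyB f g : val (f - g) = val f - val g.
Proof. exact: rmorphB. Qed.

Lemma val_sympoly_sum k (g : 'I_k -> sympoly F n) :
  val (\sum_i g i) = \sum_i val (g i).
Proof. exact: raddf_sum. Qed.

Lemma sympolyC_subproof (c : F) : c%:MP_[n] \is symmetric.
Proof. by rewrite -[c%:MP]mulr1 mul_mpolyC rpredZ // rpred1. Qed.
Definition sympolyC (c : F) : sympoly F n := SymPoly (sympolyC_subproof c).

Lemma mcoeff_sympolyCM c f m : (val (sympolyC c * f))@_m = c * (val f)@_m.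
Proof. by rewrite val_sympolyM mcoeffCM. Qed.

(** Subtracting [f_m * m_m], for [m] in the support of [f], removes the orbit of
    [m] from the support and adds nothing to it. *)
Lemma ideal_mem_of_msymp (J : sympoly F n -> Prop) f : is_ideal J ->
  (forall m, m \in msupp (val f) -> J (msymp F n m)) -> J f.
Proof.
move=> [J0 JD JM]; have [N] := ubnP (size (msupp (val f))).
elim: N f => // N IHN f ltN Jf.
case E: (msupp (val f)) => [|m r].
  by rewrite (_ : f = 0) //; apply/val_inj/msuppnil0; rewrite E.
have mf : m \in msupp (val f) by rewrite E mem_head.
pose g := f - sympolyC (val f)@_m * msymp F n m.
have gE m' : (val g)@_m' = (val f)@_m' - (val f)@_m * (perm_eq m' m)%:R.
  by rewrite /g val_sympolyB mcoeffB mcoeff_sympolyCM mcoeff_msymp.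
have -> : f = g + sympolyC (val f)@_m * msymp F n m by rewrite subrK.
have gf m' : m' \in msupp (val g) -> m' \in msupp (val f).
  rewrite !mcoeff_msupp gE; case: (boolP (perm_eq m' m)) => [e|_].
    by rewrite (symmetric_coeff (valP f) e) mulr1 subrr eqxx.
  by rewrite mulr0 subr0.
apply: JD; last by apply/JM/Jf.
apply: IHN => [|m' /gf]; last exact: Jf.
rewrite -ltnS; apply: leq_trans ltN; rewrite ltnS.
have : uniq (m :: msupp (val g)).
  by rewrite /= msupp_uniq andbT mcoeff_msupp negbK gE perm_refl mulr1 subrr.
move/uniq_leq_size; apply=> m'; rewrite inE => /predU1P[->//|]; exact: gf.
Qed.

(** The sets [S] such that dividing [x^m] by [x_S ^ a] leaves a rearrangement of
    [x^m1]: they count the occurrences of [x^m] in [m_((a^k)) * m_m1]. *)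
Definition extractions k a m m1 : {set {set 'I_n}} :=
  [set S : {set 'I_n} |
    [&& #|S| == k, (const_on a S <= m)%MM & perm_eq (m - const_on a S)%MM m1]].

Lemma mcoeff_block_msymp k a m1 m :
  (block F n k a * val (msymp F n m1))@_m = #|extractions k a m m1|%:R.
Proof.
rewrite mcoeff_blockM -sum1_card natr_sum /extractions.
rewrite [RHS](eq_bigl (fun S => ((#|S| == k) && (const_on a S <= m)%MM) &&
  perm_eq (m - const_on a S)%MM m1)) => [|S]; last by rewrite inE andbA.
rewrite [RHS]big_mkcondr /=; apply: eq_bigr => S _.
by rewrite mcoeff_msymp; case: perm_eq.
Qed.

(** The family of extractions is stable under the permutations that preserve
    [m].  At a place of [S] the exponent is at least [a > d], so regularity
    makes the size of its level set divisible by [p ^ i], whereas [|S| = k] is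
    not. *)
Lemma extractions_dvd p i k a m m1 : prime p -> (0 < k < p ^ i)%N ->
  (d < a)%N -> ~~ irregular d (p ^ i) m -> (p %| #|extractions k a m m1|)%N.
Proof.
move=> pp /andP[k0 ki] da reg.
apply: (@invariant_family_dvd _ (fun i => m i) p i) => //.
- move=> s hs S; rewrite !inE => /and3P[cS /const_on_leP le_m e].
  apply/and3P; split; first by rewrite card_imset //; apply: perm_inj.
    by apply/const_on_leP=> _ /imsetP[x xS ->]; rewrite hs le_m.
  apply: perm_trans e; apply: (perm_eq_reindex (s := s)) => x.
  by rewrite !mnmBE !const_onE hs mem_imset //; apply: perm_inj.
- move=> S; rewrite inE => /and3P[/eqP-> _ _].
  by apply/negP => /(dvdn_leq k0); rewrite leqNgt ki.
move=> S x; rewrite inE => /and3P[_ /const_on_leP le_m _] xS.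
move: reg; rewrite negb_exists => /forallP/(_ x).
by rewrite (leq_trans da (le_m _ xS)) negbK.
Qed.

Section Peeling.
Variables (a : nat) (m0 : 'X_{1..n}) (S0 : {set 'I_n}).
Hypotheses (a0 : (0 < a)%N) (S0lvl : S0 \subset level m0 a).

Lemma level_disjoint S m b c : S \subset level m b -> c != b -> S :&: level m c = set0.
Proof.
move=> Sb cb; apply/setP=> i; rewrite !inE.
case: (boolP (i \in S)) => //= /(subsetP Sb); rewrite inE => /eqP->.
by rewrite eq_sym (negPf cb).
Qed.

Lemma level_sub_const_on_level S m b : S \subset level m a ->
  (#|level (m - const_on a S)%MM b| + #|S| * (b == a) =
   #|level m b| + #|S| * (b == 0))%N.
Proof.
move=> Sa.
have le_m : (const_on a S <= m)%MM.
  by apply/const_on_leP=> i /(subsetP Sa); rewrite inE => /eqP->.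
have := level_sub_const_on b a0 le_m.
have -> : #|S :&: level m b| = (#|S| * (b == a))%N.
  case: (eqVneq b a) => [->|ba]; first by rewrite muln1 (setIidPl Sa).
  by rewrite (level_disjoint Sa ba) cards0 muln0.
suff -> : #|S :&: level m (a + b)| = (#|S| * (b == 0)%N)%N by [].
case: (eqVneq b 0%N) => [->|b0]; first by rewrite addn0 muln1 (setIidPl Sa).
by rewrite (level_disjoint Sa) ?cards0 ?muln0 // -[X in _ != X]addn0 eqn_add2l.
Qed.

(** Removing [a] from a place creates a new zero only if the exponent there is
    exactly [a].  So a set [S] leaving as many zeros as [S0] lies inside the
    level set of [a]. *)
Lemma extractions_self :
  extractions #|S0| a m0 (m0 - const_on a S0)%MM =
  [set S : {set 'I_n} | (S \subset level m0 a) && (#|S| == #|S0|)].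
Proof.
apply/setP=> S; rewrite !inE andbC [RHS]andbC.
case: (eqVneq #|S| #|S0|) => [cS|]; last by rewrite !andbF.
rewrite !andbT; apply/andP/idP => [[leS /perm_eq_levelP e]|Sa].
  have := level_sub_const_on 0 a0 leS.
  have := level_sub_const_on_level 0 S0lvl; rewrite muln1 addn0 -e ltn_eqF // muln0 addn0.
  have -> : S :&: level m0 0 = set0.
    apply/setP=> i; rewrite !inE; case: (boolP (i \in S)) => //= iS.
    by move/const_on_leP: leS => /(_ i iS); case: (m0 i) => //; rewrite leqn0 gtn_eqF.
  rewrite cards0 addn0 => -> /addnI; rewrite -cS => /esym eS.
  by apply/setIidPl/eqP; rewrite eqEcard subsetIl eS leqnn.
split; first by apply/const_on_leP=> i /(subsetP Sa); rewrite inE => /eqP->.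
apply/perm_eq_levelP=> b; apply/eqP; rewrite -(eqn_add2r (#|S| * (b == a))%N).
by rewrite (level_sub_const_on_level _ Sa) cS (level_sub_const_on_level _ S0lvl).
Qed.

(** In [m_((a^k)) * m_m1] the parts [a] are either adjoined to those of [m1], or
    some of them are added to nonzero parts of [m1]; the latter case yields
    strictly fewer nonzero parts. *)
Lemma extractions_zeros m :
  (0 < #|extractions #|S0| a m (m0 - const_on a S0)%MM|)%N ->
  (#|level m0 0| < #|level m 0|)%N \/ perm_eq m m0.
Proof.
case/card_gt0P=> S; rewrite inE => /and3P[/eqP cS leS /perm_eq_levelP e].
have e0 : (#|level m 0| + #|S :&: level m a| = #|level m0 0| + #|S|)%N.
  have := level_sub_const_on 0 a0 leS.
  have := level_sub_const_on_level 0 S0lvl.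
  rewrite muln1 addn0 -e ltn_eqF // muln0 addn0 cS => -> <-.
  rewrite (_ : S :&: level m 0 = set0) ?cards0 ?addn0 //.
  apply/setP=> i; rewrite !inE; case: (boolP (i \in S)) => //= iS.
  by move/const_on_leP: leS => /(_ i iS); case: (m i) => //; rewrite leqn0 gtn_eqF.
have [Sa|nSa] := boolP (S \subset level m a); [right|left].
  apply/perm_eq_levelP=> b; apply/eqP; rewrite -(eqn_add2r (#|S| * (b == 0))%N).
  by rewrite -(level_sub_const_on_level _ Sa) e cS (level_sub_const_on_level _ S0lvl).
rewrite -(ltn_add2r #|S|) -e0 ltn_add2l; apply: proper_card.
by rewrite properE subsetIl subsetI subxx.
Qed.
End Peeling.

(** Induction on the number of nonzero parts of [m0].  Let [a > d] be a part of
    [m0] whose multiplicity [u] is not divisible by [p ^ i], let [k] be the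
    [p]-part of [u], and replace [k] of the parts [a] by zeros.  Multiplying
    the result by [m_((a^k))] gives ['C(u, k) * m_m0], with an invertible
    coefficient, plus terms with fewer nonzero parts; by [extractions_dvd]
    these are again [p ^ i]-irregular, so the induction hypothesis applies. *)
Lemma irregular_generated (J : sympoly F n -> Prop) p i f :
    p \in [pchar F] -> is_ideal J ->
    (forall l a, (l < i)%N -> (p ^ l <= n)%N -> (d < a)%N ->
       J (msymp F n (nseq (p ^ l) a))) ->
    (forall m, m \in msupp (val f) -> irregular d (p ^ i) m) ->
  J f.
Proof.
move=> charFp idJ Jgen irrf; have pp := pcharf_prime charFp.
have [J0 JD JM] := idJ.
apply: ideal_mem_of_msymp => // m0 /irrf {f irrf}.
have [N] := ubnP (n - #|level m0 0|); elim: N m0 => // N IHN m0 ltN.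
case/existsP=> i0 /andP[]; set a := m0 i0; set V := level m0 a => da nkV.
have a0 : (0 < a)%N by apply: leq_trans da.
have V0 : (0 < #|V|)%N by apply/card_gt0P; exists i0; rewrite inE.
set l := logn p #|V|; pose k := (p ^ l)%N.
have k0 : (0 < k)%N by rewrite expn_gt0 prime_gt0.
have li : (l < i)%N by rewrite ltnNge -pfactor_dvdn.
have kV : (k <= #|V|)%N by rewrite dvdn_leq // pfactor_dvdn.
have kn : (k <= n)%N.
  by apply: leq_trans kV _; rewrite -[n in (_ <= n)%N]card_ord max_card.
have [S0 S0V cS0] : exists2 S0 : {set 'I_n}, S0 \subset V & #|S0| = k.
  case/card_geqP: kV => s [us <- sV]; exists [set x in s].
    by apply/subsetP=> x; rewrite inE => /sV.
  by rewrite cardsE; apply/card_uniqP.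
pose g := msymp F n (nseq k a) * msymp F n (m0 - const_on a S0)%MM.
have Jg : J g by rewrite /g mulrC; apply/JM/Jgen.
have gE m : (val g)@_m = #|extractions #|S0| a m (m0 - const_on a S0)%MM|%:R.
  by rewrite /g val_sympolyM val_msymp_nseq // mcoeff_block_msymp cS0.
pose c : F := (val g)@_m0.
have c0 : c != 0.
  by rewrite /c gE extractions_self // cards_draws cS0 bin_logn_neq0.
pose h := g - sympolyC c * msymp F n m0.
have hE m : (val h)@_m = (val g)@_m - c * (perm_eq m m0)%:R.
  by rewrite /h val_sympolyB mcoeffB mcoeff_sympolyCM mcoeff_msymp.
have Jh : J h.
  apply: ideal_mem_of_msymp => // m; rewrite mcoeff_msupp hE.
  case: (boolP (perm_eq m m0)) => [e|ne].
    by rewrite (symmetric_coeff (valP g) e) mulr1 subrr eqxx.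
  rewrite mulr0 subr0 gE -(dvdn_pcharf charFp) => ndvd.
  have : (0 < #|extractions #|S0| a m (m0 - const_on a S0)%MM|)%N.
    by case: posnP ndvd => // ->; rewrite dvdn0.
  case/(extractions_zeros a0 S0V) => [lt0|e]; last by rewrite e in ne.
  apply: IHN => [|].
    rewrite -ltnS; apply: leq_trans ltN; rewrite ltnS ltn_sub2l //.
    by apply: leq_trans lt0 _; rewrite -[n in (_ <= n)%N]card_ord max_card.
  apply: contraR ndvd; apply: extractions_dvd => //.
  by rewrite cS0 k0 /k ltn_exp2l ?prime_gt1.
have -> : msymp F n m0 = sympolyC c^-1 * (g - h).
  apply/val_inj/mpolyP=> m; rewrite mcoeff_sympolyCM val_sympolyB mcoeffB hE.
  by rewrite opprB addrC subrK mulrA mulVf // mul1r mcoeff_msymp.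
apply/JM/JD => //; rewrite -mulN1r; exact: JM.
Qed.
End Generation.

(** * A Newton identity modulo irregular monomials *)

Section Newton.
Local Open Scope ring_scope.
Variables (F : fieldType) (n k : nat).
Hypothesis k0 : (0 < k)%N.
Local Notation pairT := ({set 'I_n} * {set 'I_n})%type.

(** The part of [block k a * block l 1] indexed by the pairs that satisfy [P]. *)
Definition pair_sum (P : pred pairT) a l : {mpoly F[n]} :=
  \sum_(ST : pairT | [&& #|ST.1| == k, #|ST.2| == l & P ST])
    'X_[(const_on a ST.1 + const_on 1 ST.2)%MM].

Definition disj : pred pairT := fun ST => [disjoint ST.1 & ST.2].
Definition nested : pred pairT := fun ST => ST.1 \subset ST.2.
Definition mixed : pred pairT := fun ST => ~~ disj ST && ~~ nested ST.

(** As [S] is nonempty, it is not both disjoint from [T] and contained in it. *)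
Lemma block_mul a l : block F n k a * block F n l 1 =
  pair_sum disj a l + pair_sum nested a l + pair_sum mixed a l.
Proof.
have -> : block F n k a * block F n l 1 = pair_sum predT a l.
  rewrite /block /pair_sum big_distrlr pair_big /=.
  by apply: eq_big => [[S T]|[S T] _] /=; rewrite ?andbT // mpolyXD.
rewrite /pair_sum !(big_mkcond (fun ST => [&& _, _ & _])) -!big_split /=.
apply: eq_bigr => -[S T] _ /=; rewrite /mixed /disj /nested /= !andbT.
case: (eqVneq #|S| k) => [cS|_]; last by rewrite !addr0.
case: (#|T| == l) => /=; last by rewrite !addr0.
case: (boolP [disjoint S & T]) => [dST|_]; case: (boolP (S \subset T)) => sST /=;
  rewrite ?addr0 ?add0r //.
move: dST; rewrite disjoints_subset => /(subsetP)dST.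
have /card_gt0P[x xS] : (0 < #|S|)%N by rewrite cS.
by have := dST x xS; rewrite inE (subsetP sST x xS).
Qed.

(** The pairs [(S, T)], with [S] and [T] disjoint, and [(S, S :|: T)] give the
    same monomial when the exponent on [S] drops by one. *)
Lemma pair_sum_disj_nested a l :
  pair_sum disj a.+1 l = pair_sum nested a (k + l).
Proof.
rewrite /pair_sum.
rewrite (reindex_onto (fun ST : pairT => (ST.1, ST.2 :\: ST.1))
  (fun ST : pairT => (ST.1, ST.1 :|: ST.2))) => [|[S T] /and3P[_ _ dST]] /=; last first.
  rewrite setDUl setDv set0U; congr (_, _); apply/setDidPl.
  by rewrite disjoint_sym.
apply: eq_big => [[S T]|[S T] /=]; rewrite /disj /nested /=.
  case: (eqVneq #|S| k) => //= cS; rewrite xpair_eqE eqxx /=.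
  have -> : [disjoint S & T :\: S]
    by rewrite -setI_eq0; apply/eqP/setP=> x; rewrite !inE; case: (x \in S).
  rewrite andbT -[S :|: _]/(_ :|: _) (_ : S :|: T :\: S = S :|: T); last first.
    by apply/setP=> x; rewrite !inE; case: (x \in S).
  rewrite (sameP eqP setUidPr) [RHS]andbC [LHS]andbC.
  case: (boolP (S \subset T)) => //= sST.
  by rewrite cardsD (setIidPr sST) cS -(eqn_add2l k) subnKC // -cS subset_leq_card.
case/andP=> _ /eqP[e]; congr 'X_[_]; apply/mnmP=> x.
have sST : S \subset T by rewrite -e subsetUl.
rewrite !mnmDE !const_onE !inE !mul1n.
case: (boolP (x \in S)) => [/(subsetP sST) ->|_] /=; first by rewrite !muln1 addn0 addn1.
by rewrite !muln0.
Qed.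

Lemma pair_sum_large a l : (n < k + l)%N -> pair_sum disj a l = 0.
Proof.
move=> nkl; apply: big1 => -[S T] /= /and3P[/eqP cS /eqP cT dST].
have := leq_card_setU S T; rewrite (dST : [disjoint S & T]) cS cT => -[_ /eqP e].
by have := max_card (S :|: T); rewrite e card_ord leqNgt nkl.
Qed.

Lemma pair_sum_nested0 a : pair_sum nested a 0 = 0.
Proof.
apply: big1 => -[S T] /= /and3P[/eqP cS]; rewrite cards_eq0 => /eqP->.
by rewrite /nested /= subset0 -cards_eq0 cS gtn_eqF.
Qed.

(** The exponent [a + 1] occurs exactly on [S :&: T], and [0 < |S :&: T| < k]. *)
Lemma irregular_mixed d a l m : (d < a)%N ->
  m \in msupp (pair_sum mixed a l) -> irregular d k m.
Proof.
move=> da; have a0 : (0 < a)%N := leq_ltn_trans (leq0n d) da.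
move/msupp_sum_le; case/flatten_mapP=> -[S T].
rewrite mem_filter /mixed /disj /nested /= => /andP[/and3P[/eqP cS _ /andP[nd ns]] _].
rewrite msuppX inE => /eqP->.
have lvlE : level (const_on a S + const_on 1 T)%MM a.+1 = S :&: T.
  apply/setP=> x; rewrite !inE mnmDE !const_onE mul1n.
  case: (x \in S); case: (x \in T) => /=; rewrite ?muln1 ?muln0 ?addn0 ?addn1 ?eqxx //.
  - by rewrite ltn_eqF.
  - by rewrite eqSS ltn_eqF.
have /set0Pn[x xST] : S :&: T != set0 by rewrite setI_eq0.
have mx : (const_on a S + const_on 1 T)%MM x = a.+1.
  by move: xST; rewrite -lvlE inE => /eqP.
apply/existsP; exists x; rewrite mx lvlE ltnS ltnW //=.
apply/negP=> /dvdn_leq le_k.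
have : (k <= #|S :&: T|)%N by apply: le_k; apply/card_gt0P; exists x.
by rewrite leqNgt -cS proper_card // properE subsetIl subsetI subxx.
Qed.

(** Newton's identity for the functions [m_((a^k))]: the disjoint pairs of index
    [j] cancel the nested pairs of index [j + 1], those of the last index do
    not fit into [n] variables, and only mixed pairs remain.  For [k = 1] there
    are none, and this is the classical identity for power sums. *)
Lemma newton_irregular d a q (m : 'X_{1..n}) : (d + q < a)%N -> (n < q.+1 * k)%N ->
  m \in msupp (\sum_(j < q.+1)
    (-1) ^+ j *: (block F n k (a - j)%N * block F n (j * k)%N 1)) ->
  irregular d k m.
Proof.
move=> dqa nqk.
pose B j := pair_sum nested (a - j)%N (j * k)%N.
have -> : \sum_(j < q.+1) (-1) ^+ j *: (block F n k (a - j)%N * block F n (j * k)%N 1) =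
    \sum_(j < q.+1) (-1) ^+ j *: pair_sum mixed (a - j)%N (j * k)%N.
  have DB (j : 'I_q.+1) : pair_sum disj (a - j)%N (j * k)%N = B j.+1.
    rewrite /B mulSn -pair_sum_disj_nested -subSn ?subSS //.
    by rewrite (leq_trans (ltn_ord j)) // (leq_trans _ dqa) // ltnS leq_addl.
  have BS : B q.+1 = 0 by rewrite -(DB ord_max) pair_sum_large //= -mulSn.
  have B0 : B 0%N = 0 by exact: pair_sum_nested0.
  apply/eqP; rewrite -subr_eq0 -sumrB.
  rewrite (eq_bigr (fun j : 'I_q.+1 => - ((-1) ^+ j.+1 *: B j.+1 - (-1) ^+ j *: B j))).
    rewrite sumrN -(big_mkord xpredT
      (fun j => (-1) ^+ j.+1 *: B j.+1 - (-1) ^+ j *: B j)).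
    by rewrite telescope_sumr // BS B0 !scaler0 subrr oppr0.
  move=> j _; rewrite block_mul -scalerBr addrK DB scalerDr exprS mulN1r scaleNr.
  by rewrite opprD !opprK.
move/msupp_sum_le/flatten_mapP=> -[j _ /msuppZ_le]; apply: irregular_mixed.
by rewrite ltn_subRL addnC (leq_ltn_trans _ dqa) // leq_add2l -ltnS.
Qed.
End Newton.

(** * The ideal generated by the powers of the variables *)

Section Membership.
Local Open Scope ring_scope.
Variables (F : fieldType) (n d : nat).

Lemma I_ideal_ideal : is_ideal (@I_ideal F n d).
Proof.
have [I0 ID IM] := ideal_gen_ideal (fun k : 'I_n => 'X_k ^+ d.+1 : {mpoly F[n]}).
split=> [|f g If Ig|f g Ig].
- exact: I0.
- exact: ID If Ig.
- by rewrite /I_ideal val_sympolyM; apply: IM.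
Qed.

Lemma I_idealP (f : sympoly F n) :
  I_ideal d f <-> forall m, m \in msupp (val f) -> exists i, (d < m i)%N.
Proof.
split=> [[c ->] m|expf].
  move/msupp_sum_le/flatten_mapP=> -[k _].
  rewrite mpolyXn (perm_mem (msuppMX _ _)) => /mapP[m' _ ->].
  by exists k; rewrite mnmDE mulmnE mnm1E eqxx mul1n leq_addr.
rewrite /I_ideal [val f]mpolyE; set g := fun k : 'I_n => _.
have idI := ideal_gen_ideal g; have [_ _ IM] := idI.
apply: ideal_big_sum => // m /expf[i di].
rewrite -mul_mpolyC; apply: (IM).
have le_m : (U_(i) *+ d.+1 <= m)%MM.
  apply/mnm_lepP=> j; rewrite mulmnE mnm1E.
  by case: eqP => [<-|_]; rewrite ?mul1n.
rewrite -(submK le_m) mpolyXD -mpolyXn; apply: (IM).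
exact: (ideal_gen_mem g i).
Qed.
End Membership.

Theorem theorem4p3 (F : fieldType) (p n d t : nat) (q r : 'I_t.+1 -> nat)
    (hp : p \in [pchar F]%R) (hn : 0 < n)
    (ht : p ^ t <= n) (ht_max : forall i : nat, p ^ i <= n -> i <= t)
    (hq : forall i : 'I_t.+1,
       [/\ 0 < q i, n = q i * p ^ i + r i & r i < p ^ i]) :
  forall f : sympoly F n,
    I_ideal d f <-> ideal_sum (fun i : 'I_t.+1 => @J_ideal F n d p i (q i)) f.
Proof.
have pp := pcharf_prime hp.
pose Jt := fun i : 'I_t.+1 => @J_ideal F n d p i (q i).
have idJt i : is_ideal (Jt i) by apply: ideal_gen_ideal.
have idJ := ideal_sum_ideal idJt.
have [J0 JD JM] := idJ.
have pt (i : 'I_t.+1) : (0 < p ^ i <= n)%N.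
  rewrite expn_gt0 prime_gt0 //=; apply: leq_trans ht.
  by rewrite leq_exp2l ?prime_gt1 // -ltnS.
(* The error terms in Newton's identity for p^i are generated by the
   m_((a^(p^l))) with l < i, hence the induction on i. *)
have Jgen : forall i, i <= t.+1 -> forall l a, l < i -> p ^ l <= n -> d < a ->
    ideal_sum Jt (msymp F n (nseq (p ^ l) a)).
  elim=> // i IHi it l a; rewrite ltnS leq_eqVlt => /predU1P[->|li]; last first.
    by apply: IHi => //; apply: ltnW.
  move=> kn; pose i0 := Ordinal it; have [q0 en ri] := hq i0.
  have nqk : (n < (q i0).+1 * p ^ i)%N by rewrite en mulSn addnC ltn_add2r.
  have [k0 _] := andP (pt i0).
  (* For a > d + q_i, Newton's identity expresses m_((a^(p^i))) through the
     q_i preceding ones, all with parts above d. *)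
  have [N] := ubnP a; elim: N a => // N IHN a aN da.
  have [aq|qa] := leqP a (d + q i0).
    have lt_aq : (a - d.+1 < q i0)%N by rewrite ltn_subLR // addSn ltnS.
    have -> : a = (d + (Ordinal lt_aq).+1)%N by rewrite /= addnS -addSn subnKC.
    by apply: (ideal_sum_sub (i := i0)) => //; apply: ideal_gen_mem.
  pose g (j : 'I_(q i0).+1) := (sympolyC n ((-1) ^+ j) *
    (msymp F n (nseq (p ^ i)%N (a - j)%N) * msymp F n (nseq (j * p ^ i)%N 1%N)))%R.
  have lea (j : 'I_(q i0).+1) : d < a - j.
    by rewrite ltn_subRL addnC (leq_ltn_trans _ qa) // leq_add2l -ltnS.
  have Jsum : ideal_sum Jt (\sum_j g j)%R.
    apply: (irregular_generated (d := d) (i := i) hp idJ).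
      by move=> l' b l'i; apply: IHi => //; apply: ltnW.
    move=> m mg; apply: (newton_irregular (F := F) k0 qa nqk).
    move: mg; rewrite val_sympoly_sum; congr (_ \in msupp _); apply: eq_bigr => j _.
    rewrite /g !val_sympolyM !val_msymp_nseq //.
    - by rewrite mul_mpolyC.
    - rewrite en; apply: leq_trans (leq_addr _ _).
      by rewrite leq_mul2r -ltnS ltn_ord orbT.
    - exact: leq_ltn_trans (lea j).
  have g0 : g ord0 = msymp F n (nseq (p ^ i)%N a).
    apply/val_inj; rewrite /g !val_sympolyM /= -!/(val (msymp _ _ _)).
    rewrite -[monomial_sum F n (nseq (0 * _) 1)]/(val (msymp F n (nseq 0 1))).
    by rewrite val_msymp_nseq // block0 mulr1 mul1r subn0.
  rewrite -g0 -[g ord0](addrK (\sum_(j < q i0) g (lift ord0 j))%R) -big_ord_recl.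
  apply: (JD) => //; rewrite -mulN1r; apply: (JM).
  apply: (ideal_big_sum idJ) => j _; rewrite /g [(msymp _ _ _ * _)%R]mulrC.
  do 2 apply: (JM); apply: IHN => //.
  rewrite /= /bump add1n -ltnS; apply: leq_trans aN; rewrite ltnS.
  by rewrite ltn_subrL /= (leq_ltn_trans _ da).
move=> f; split=> [/I_idealP expf|[g [Jg ->]]].
  (* Multiplicities are at most n < p^(t+1): a positive one is never divisible
     by p^(t+1). *)
  apply: (irregular_generated (d := d) (i := t.+1) hp idJ); first exact: Jgen.
  move=> m /expf[i di]; apply/existsP; exists i; rewrite di /=.
  apply/negP=> /dvdn_leq le_pt.
  have le_lvl : p ^ t.+1 <= #|level m (m i)|.
    by apply: le_pt; apply/card_gt0P; exists i; rewrite inE.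
  suff : t.+1 <= t by rewrite ltnn.
  apply/ht_max/(leq_trans le_lvl).
  by rewrite -[n in _ <= n]card_ord max_card.
have [I0 ID IM] := I_ideal_ideal F n d.
apply: ideal_big_sum; first exact: I_ideal_ideal.
move=> i _; case: (Jg i) => c ->; apply: ideal_big_sum; first exact: I_ideal_ideal.
move=> j _; apply: IM; apply/I_idealP=> m; have /andP[pi0 pin] := pt i.
have a0 : 0 < d + j.+1 by rewrite addnS.
rewrite val_msymp_nseq // => /msupp_sum_le/flatten_mapP[S].
rewrite mem_filter => /andP[/eqP cS _]; rewrite msuppX inE => /eqP->.
have /card_gt0P[x xS] : 0 < #|S| by rewrite cS.
by exists x; rewrite const_onE xS muln1 addnS ltnS leq_addr.
Qed.
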